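(* Assume (A3) and (A4) (see context). Let $(Y,u,P,Q)$ be processes, with $Y,P$ valued in $\mathbb R^n$, $u=(u^0,\dots,u^n)$ valued in $\mathbb R^{d_0}\times\dots\times\mathbb R^{d_n}$ and $Q=(Q^1,\dots,Q^n)$ valued in $\mathbb R^{n\times n}$, satisfying for $t\in[0,T]$ $$B_{v^0}(t,Y_{t-},\mathcal L(Y_{t-}),u^0_t)^\top P_{t-}+f^0_{v^0}(t,Y_{t-},\mathcal L(Y_{t-}),u^0_t)=0,$$ $$A^j_{v^j}(t,Y_{t-},\mathcal L(Y_{t-}),u^j_t)^\top Q^j_t+f^j_{v^j}(t,Y_{t-},\mathcal L(Y_{t-}),u^j_t)=0,\qquad1\le j\le n,\ d_j>0.$$ Then, for $1\le j\le n$ with $d_j>0$, $$|P_{t-}|\le\frac{L^2}{\lambda_0}\big[1+|Y_{t-}|+|\mathcal L(Y_{t-})|_1+|u^0_t|\big],\qquad|Q^j_t|\le\frac{L^2}{\lambda_0}\big[1+|Y_{t-}|+|\mathcal L(Y_{t-})|_1+|u^j_t|\big],$$ and also $$|u^0_t|\le\frac{L}{2\lambda_v}\big[1+|P_{t-}|+|Y_{t-}|+|\mathcal L(Y_{t-})|_1\big],\qquad|u^j_t|\le\frac{L}{2\lambda_v}\big[1+|Q^j_t|+|Y_{t-}|+|\mathcal L(Y_{t-})|_1\big].$$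
   Context: Notation. $(\Omega,\mathscr F,\mathbb P)$ is the underlying complete probability space; processes are indexed by $[0,T]$, $Y,P$ have left limits $Y_{t-},P_{t-}$, and the laws $\mathcal L(Y_{t-})$ belong to $\mathcal P_2(\mathbb R^n)$, the space of probability measures with finite second moment, with the 2-Wasserstein metric $W_2$; $|m|_1=\int|x|m(dx)$, $|m|_2=(\int|x|^2m(dx))^{1/2}$; $\|\xi\|_2$ is the $L^2(\Omega)$-norm. $(E,\mathcal B(E),\lambda)$, $E=\mathbb R^\kappa\setminus\{0\}$, is a measure space with $\int_E(1+|e|^2)\lambda(de)<\infty$ and $\|h\|_{L^2_\lambda}^2=\int_E|h|^2d\lambda$. The linear functional-derivative of $k:\mathcal P_2(\mathbb R^n)\to\mathbb R$ is a jointly continuous $(m,y)\mapsto\frac{dk}{d\nu}(m)(y)$ with $\int|\frac{dk}{d\nu}(m)(y)|^2m(dy)\le c(m)$ ($c$ bounded on bounded sets) and $\lim_{\epsilon\to0}\epsilon^{-1}[k((1-\epsilon)m+\epsilon m')-k(m)]=\int\frac{dk}{d\nu}(m)(y)(m'-m)(dy)$ for all $m'$; $D_y$ is the gradient in $y$. $L>0$ is a constant. Coefficients: $b$ ($\mathbb R^n$-valued) and $\sigma=(\sigma^1,\dots,\sigma^n)$ ($\mathbb R^{n\times n}$-valued, columns $\sigma^j$) on $[0,T]\times\mathbb R^n\times\mathcal P_2(\mathbb R^n)\times\mathbb R^d$, jump coefficient $\gamma$, running cost $f:[0,T]\times\mathbb R^n\times\mathcal P_2(\mathbb R^n)\times\mathbb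 R^d\to\mathbb R$, terminal cost $g:\mathbb R^n\times\mathcal P_2(\mathbb R^n)\to\mathbb R$. (A3) $d=\sum_{j=0}^nd_j$ with integers $d_0>0$, $d_1,\dots,d_n\ge0$; $v=(v^0,\dots,v^n)$, $v^j\in\mathbb R^{d_j}$; $J=\{0\}\cup\{1\le j\le n:d_j>0\}$. There are maps $A^j:[0,T]\times\mathbb R^n\times\mathcal P_2(\mathbb R^n)\times\mathbb R^{d_j}\to\mathbb R^n$, $j\in J$ (write $B:=A^0$), with $b(t,x,m,v)=B(t,x,m,v^0)$ and $\sigma^j(t,x,m,v)=A^j(t,x,m,v^j)$ for $j\in J$, $j\ge1$. Each $A^j$ is continuous, $|A^j|\le L(1+|x|+|m|_2+|v^j|)$, differentiable in $(x,v^j)$ and linearly functional-differentiable in $m$, with $A^j_x,A^j_{v^j},D_y\frac{dA^j}{d\nu}$ continuous and bounded in norm by $L$. There are constants $0\le L_0,L_1,L_2\le L$, $\lambda_0>0$ such that for all $j\in J$ and all arguments, with $\Delta_j:=1+|x|\vee|x'|+|m|_1\vee|m'|_1+|v^j|\vee|v'^j|$: $|A^j_x(t,x',m',v'^j)-A^j_x(t,x,m,v^j)|\le\Delta_j^{-1}(L_0|x'-x|+L_0W_2(m,m')+L_1|v'^j-v^j|)$; $|D_y\frac{dA^j}{d\nu}(t,x',m',v'^j)(y')-D_y\frac{dA^j}{d\nu}(t,x,m,v^j)(y)|\le\Delta_j^{-1}(L_0|x'-x|+L_0W_2(m,m')+L_0|y'-y|+L_1|v'^j-v^j|)$; $|A^j_{v^j}(t,x',m',v'^j)-A^j_{v^j}(t,x,m,v^j)|\le\Delta_j^{-1}(L_1|x'-x|+L_1W_2(m,m')+L_2|v'^j-v^j|)$;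 $A^j_{v^j}(A^j_{v^j})^\top(t,x,m,v^j)\ge\lambda_0I_n$. For $1\le j\le n$ with $d_j=0$: $\sigma^j(t,x,m)=\sigma^j_0(t)+\sigma^j_1(t)x+\sigma^j_2(t)\int y\,m(dy)$ with deterministic coefficients bounded in norm by $L$. $\gamma(t,x,m,e)=\gamma_0(t,e)+\gamma_1(t,e)x+\gamma_2(t,e)\int y\,m(dy)$ with $\|\gamma_i(t,\cdot)\|_{L^2_\lambda}\le L$. $f(t,x,m,v)=\sum_{j=0}^nf^j(t,x,m,v^j)$ with $|(f^j_x,f^j_{v^j})|\le L(1+|x|+|m|_1+|v^j|)$, $|D_y\frac{df^j}{d\nu}(t,x,m,v^j)(y)|\le L(1+|x|+|m|_1+|v^j|+|y|)$, these derivatives being $L$-Lipschitz in $(x,m,v^j,y)$. (A4) There are $\lambda_v>0$ and $\lambda_x,\lambda_m$ with $\lambda_x+\lambda_m>0$ such that for all $t\in[0,T]$, $x,x'\in\mathbb R^n$, $v,v'\in\mathbb R^d$, $\xi,\xi'\in L^2(\Omega,\mathscr F,\mathbb P;\mathbb R^n)$: $f(t,x',\mathcal L(\xi'),v')-f(t,x,\mathcal L(\xi),v)\ge f_x(t,x,\mathcal L(\xi),v)^\top(x'-x)+f_v(t,x,\mathcal L(\xi),v)^\top(v'-v)+\mathbb E[(D_y\frac{df}{d\nu}(t,x,\mathcal L(\xi),v)(\xi))^\top(\xi'-\xi)]+\lambda_v|v'-v|^2+\lambda_x|x'-x|^2+\lambda_m\|\xi'-\xi\|_2^2$; $g(x',\mathcal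 L(\xi'))-g(x,\mathcal L(\xi))\ge g_x(x,\mathcal L(\xi))^\top(x'-x)+\mathbb E[(D_y\frac{dg}{d\nu}(x,\mathcal L(\xi))(\xi))^\top(\xi'-\xi)]$; and for $m\in\mathcal P_2(\mathbb R^n)$, $y,y'\in\mathbb R^n$: $\frac{df}{d\nu}(t,x,m,v)(y')-\frac{df}{d\nu}(t,x,m,v)(y)\ge(D_y\frac{df}{d\nu}(t,x,m,v)(y))^\top(y'-y)$ and $\frac{dg}{d\nu}(x,m)(y')-\frac{dg}{d\nu}(x,m)(y)\ge(D_y\frac{dg}{d\nu}(x,m)(y))^\top(y'-y)$. *)

(* Defs.v *)
From HB Require Import structures.
From mathcomp Require Import all_boot all_order all_algebra.
From mathcomp Require Import all_classical all_reals all_analysis.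

Set Implicit Arguments.
Unset Strict Implicit.
Unset Printing Implicit Defensive.
Import Order.TTheory GRing.Theory Num.Theory.
Import numFieldNormedType.Exports.
Local Open Scope classical_set_scope.
Local Open Scope ring_scope.

Section Euclidean.
Context {R : realType}.

Definition dot n (x y : 'cV[R]_n) : R := \sum_i x i ord0 * y i ord0.

(* Vectors of R^n are columns 'cV[R]_n. The library norm `|x| on matrices is
   the sup norm, hence a separate Euclidean norm. *)
Definition enorm n (x : 'cV[R]_n) : R := Num.sqrt (dot x x).

Definition opnorm m n (M : 'M[R]_(m, n)) : R :=
  sup [set enorm (M *m x) | x in [set x : 'cV[R]_n | enorm x <= 1]].

Definition loewner_le n (M N : 'M[R]_n) : Prop :=
  forall z : 'cV[R]_n, dot z (M *m z) <= dot z (N *m z).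

Definition grad n (k : 'cV[R]_n -> R) (x : 'cV[R]_n) : 'cV[R]_n :=
  \col_i 'D_(delta_mx i ord0) (k : 'cV[R]_n -> R^o) x.

(* Rows index the components of F, columns the variables; the library's
   'J F x is the transpose, for row vectors. *)
Definition jac m n (F : 'cV[R]_n -> 'cV[R]_m) (x : 'cV[R]_n) : 'M[R]_(m, n) :=
  \matrix_(i, j) ('D_(delta_mx j ord0) F x) i ord0.

Definition cont_in (X : Type) (W : normedModType R) (D : set X)
    (dist : X -> X -> R) (F : X -> W) : Prop :=
  forall p, D p -> forall e, 0 < e -> exists2 r, 0 < r &
    forall q, D q -> dist p q < r -> `|F q - F p| < e.

End Euclidean.

Definition borel (T : ptopologicalType) := g_sigma_algebraType (@open T).
HB.instance Definition _ (T : ptopologicalType) := Measurable.on (borel T).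

Section Measures.
Context {R : realType}.

Section Mixture.
Context {d} {T : measurableType d} (s : {i01 R}) (m m' : probability T R).

Definition mixture : set T -> \bar R :=
  measure_add (mscale ((1 - s%:num)%:nng) m) (mscale (s%:num%:nng) m').

HB.instance Definition _ := Measure.on mixture.

Lemma mixtureE (A : set T) :
  mixture A = ((1 - s%:num)%:E * m A + s%:num%:E * m' A)%E.
Proof. by rewrite /mixture measure_addE. Qed.

Let mixture_setT : mixture setT = 1%E.
Proof. by rewrite mixtureE !probability_setT !mule1 -EFinD subrK. Qed.

HB.instance Definition _ := Measure_isProbability.Build _ _ _ mixture
  mixture_setT.

End Mixture.

Definition Pr n := probability (borel 'cV[R]_n) R.

Definition L2norm d (T : measurableType d) (mu : {measure set T -> \bar R})
    (D : set T) n (h : T -> 'cV[R]_n) : \bar R :=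
  ((\int[mu]_(x in D) (enorm (h x) ^+ 2)%:E) `^ 2^-1)%E.

Definition P2 n : set (Pr n) :=
  [set m : Pr n | (\int[m]_x (enorm (x : 'cV[R]_n) ^+ 2)%:E < +oo)%E].

Definition moment1 n (m : Pr n) : R := \int[m]_x enorm (x : 'cV[R]_n).

Definition moment2 n (m : Pr n) : R :=
  fine (L2norm m setT (fun x => x : 'cV[R]_n)).

Definition mean n (m : Pr n) : 'cV[R]_n :=
  \col_i \int[m]_y (y : 'cV[R]_n) i ord0.

Definition coupling n (m m' : Pr n) :
    set (probability (borel 'cV[R]_n * borel 'cV[R]_n)%type R) :=
  [set pi | forall A : set (borel 'cV[R]_n), measurable A ->
     pi (A `*` setT) = m A /\ pi (setT `*` A) = m' A].

Definition W2 n (m m' : Pr n) : R :=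
  Num.sqrt (fine (ereal_inf
    [set (\int[pi]_z (enorm ((z.1 : 'cV[R]_n) - z.2) ^+ 2)%:E)%E
    | pi in coupling m m'])).

(* [dk] is a linear functional derivative of [k]; it is determined only up to
   an additive constant depending on the measure. Integrability of [dk m]
   against every m' in P2 is what gives the right-hand side of the limit a
   meaning. *)
Record is_lfd n (k : Pr n -> R) (dk : Pr n -> 'cV[R]_n -> R) : Prop := {
  lfd_continuous :
    cont_in (X := (Pr n * 'cV[R]_n)%type) (W := R^o) (P2 (n := n) `*` setT)
      (fun p q => W2 p.1 q.1 + enorm (q.2 - p.2)) (fun p => dk p.1 p.2);
  lfd_growth : exists c : Pr n -> R,
    (forall m0 r, P2 m0 -> exists C, forall m, P2 m -> W2 m0 m <= r ->
       `|c m| <= C) /\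
    (forall m, P2 m -> (\int[m]_y (dk m y ^+ 2)%:E <= (c m)%:E)%E);
  lfd_integrable : forall m m', P2 m -> P2 m' ->
    m'.-integrable setT (fun y => (dk m y)%:E);
  lfd_limit : forall m m', P2 m -> P2 m' -> forall e, 0 < e ->
    exists2 r, 0 < r & forall s : {i01 R}, 0 < s%:num < r ->
      `|s%:num^-1 * (k (mixture s m m') - k m)
        - (\int[m']_y dk m y - \int[m]_y dk m y)| < e }.

End Measures.

Arguments Pr R n : clear implicits.
Arguments P2 {R n}.

Section Assumptions.
Context {R : realType}.

Definition domain4 (T : R) n k :
    set (R * 'cV[R]_n * Pr R n * 'cV[R]_k) :=
  [set p | p.1.1.1 \in `[0, T] /\ P2 p.1.2].

Definition dist4 n k (p q : R * 'cV[R]_n * Pr R n * 'cV[R]_k) : R :=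
  `|q.1.1.1 - p.1.1.1| + enorm (q.1.1.2 - p.1.1.2) + W2 p.1.2 q.1.2
  + enorm (q.2 - p.2).

Definition domain5 (T : R) n k :
    set (R * 'cV[R]_n * Pr R n * 'cV[R]_k * 'cV[R]_n) :=
  [set p | domain4 T p.1].

Definition dist5 n k (p q : R * 'cV[R]_n * Pr R n * 'cV[R]_k * 'cV[R]_n) : R :=
  dist4 p.1 q.1 + enorm (q.2 - p.2).

(* The Delta_j of the weighted Lipschitz conditions. *)
Definition weight n k (x x' : 'cV[R]_n) (m m' : Pr R n) (v v' : 'cV[R]_k) : R :=
  1 + Num.max (enorm x) (enorm x') + Num.max (moment1 m) (moment1 m')
  + Num.max (enorm v) (enorm v').

(* [A] stands for one A^j, with v^j in R^k, and [dA] for its linear functional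
   derivative in the measure argument, taken componentwise. *)
Record A3_drift (T L L0 L1 L2 lam0 : R) n k
    (A : R -> 'cV[R]_n -> Pr R n -> 'cV[R]_k -> 'cV[R]_n)
    (dA : R -> 'cV[R]_n -> Pr R n -> 'cV[R]_k -> 'cV[R]_n -> 'cV[R]_n)
    : Prop := {
  A3_A_continuous : cont_in (domain4 (k := k) T) (@dist4 n k)
    (fun p => A p.1.1.1 p.1.1.2 p.1.2 p.2);
  A3_A_growth : forall t x m v, t \in `[0, T] -> P2 m ->
    enorm (A t x m v) <= L * (1 + enorm x + moment2 m + enorm v);
  A3_A_differentiable : forall t x m v, t \in `[0, T] -> P2 m ->
    differentiable (fun z : 'cV[R]_n * 'cV[R]_k => A t z.1 m z.2) (x, v);
  A3_A_lfd : forall t x v i, t \in `[0, T] ->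
    is_lfd (fun m => A t x m v i ord0) (fun m y => dA t x m v y i ord0);
  A3_dA_differentiable : forall t x m v y, t \in `[0, T] -> P2 m ->
    differentiable (dA t x m v) y;
  A3_Ax_continuous : cont_in (domain4 (k := k) T) (@dist4 n k)
    (fun p => jac (fun z => A p.1.1.1 z p.1.2 p.2) p.1.1.2);
  A3_Av_continuous : cont_in (domain4 (k := k) T) (@dist4 n k)
    (fun p => jac (A p.1.1.1 p.1.1.2 p.1.2) p.2);
  A3_DydA_continuous : cont_in (domain5 (k := k) T) (@dist5 n k)
    (fun p => jac (dA p.1.1.1.1 p.1.1.1.2 p.1.1.2 p.1.2) p.2);
  A3_Ax_bound : forall t x m v, t \in `[0, T] -> P2 m ->
    opnorm (jac (fun z => A t z m v) x) <= L;
  A3_Av_bound : forall t x m v, t \in `[0, T] -> P2 m ->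
    opnorm (jac (A t x m) v) <= L;
  A3_DydA_bound : forall t x m v y, t \in `[0, T] -> P2 m ->
    opnorm (jac (dA t x m v) y) <= L;
  A3_Ax_lipschitz : forall t x x' m m' v v',
    t \in `[0, T] -> P2 m -> P2 m' ->
    opnorm (jac (fun z => A t z m' v') x' - jac (fun z => A t z m v) x)
    <= (weight x x' m m' v v')^-1
       * (L0 * enorm (x' - x) + L0 * W2 m m' + L1 * enorm (v' - v));
  A3_DydA_lipschitz : forall t x x' m m' v v' y y',
    t \in `[0, T] -> P2 m -> P2 m' ->
    opnorm (jac (dA t x' m' v') y' - jac (dA t x m v) y)
    <= (weight x x' m m' v v')^-1
       * (L0 * enorm (x' - x) + L0 * W2 m m' + L0 * enorm (y' - y)
          + L1 * enorm (v' - v));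
  A3_Av_lipschitz : forall t x x' m m' v v',
    t \in `[0, T] -> P2 m -> P2 m' ->
    opnorm (jac (A t x' m') v' - jac (A t x m) v)
    <= (weight x x' m m' v v')^-1
       * (L1 * enorm (x' - x) + L1 * W2 m m' + L2 * enorm (v' - v));
  A3_Av_elliptic : forall t x m v, t \in `[0, T] -> P2 m ->
    loewner_le (lam0%:M) (jac (A t x m) v *m (jac (A t x m) v)^T) }.

(* [f] stands for one f^j, with v^j in R^k, and [df] for its linear functional
   derivative in the measure argument. *)
Record A3_cost (T L : R) n k
    (f : R -> 'cV[R]_n -> Pr R n -> 'cV[R]_k -> R)
    (df : R -> 'cV[R]_n -> Pr R n -> 'cV[R]_k -> 'cV[R]_n -> R) : Prop := {
  A3_f_differentiable : forall t x m v, t \in `[0, T] -> P2 m ->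
    differentiable
      ((fun z => f t z.1 m z.2) : 'cV[R]_n * 'cV[R]_k -> R^o) (x, v);
  A3_f_lfd : forall t x v, t \in `[0, T] ->
    is_lfd (fun m => f t x m v) (fun m => df t x m v);
  A3_df_differentiable : forall t x m v y, t \in `[0, T] -> P2 m ->
    differentiable (df t x m v : 'cV[R]_n -> R^o) y;
  A3_fxv_growth : forall t x m v, t \in `[0, T] -> P2 m ->
    enorm (col_mx (grad (fun z => f t z m v) x) (grad (f t x m) v))
    <= L * (1 + enorm x + moment1 m + enorm v);
  A3_Dydf_growth : forall t x m v y, t \in `[0, T] -> P2 m ->
    enorm (grad (df t x m v) y)
    <= L * (1 + enorm x + moment1 m + enorm v + enorm y);
  A3_fx_lipschitz : forall t x x' m m' v v',
    t \in `[0, T] -> P2 m -> P2 m' ->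
    enorm (grad (fun z => f t z m' v') x' - grad (fun z => f t z m v) x)
    <= L * (enorm (x' - x) + W2 m m' + enorm (v' - v));
  A3_fv_lipschitz : forall t x x' m m' v v',
    t \in `[0, T] -> P2 m -> P2 m' ->
    enorm (grad (f t x' m') v' - grad (f t x m) v)
    <= L * (enorm (x' - x) + W2 m m' + enorm (v' - v));
  A3_Dydf_lipschitz : forall t x x' m m' v v' y y',
    t \in `[0, T] -> P2 m -> P2 m' ->
    enorm (grad (df t x' m' v') y' - grad (df t x m v) y)
    <= L * (enorm (x' - x) + W2 m m' + enorm (v' - v) + enorm (y' - y)) }.

Definition punctured kappa : set (borel 'cV[R]_kappa) :=
  [set e | (e : 'cV[R]_kappa) != 0].

(* The control dimensions d_0, ..., d_n are [dims : 'I_n.+1 -> nat], a control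
   v in R^d is a block column with v^j = submxcol v j, and the column sigma^j,
   1 <= j <= n, is [col i sigma] with j = lift ord0 i. *)
Definition activeJ n (dims : 'I_n.+1 -> nat) : pred 'I_n.+1 :=
  fun j => (j == ord0) || (0 < dims j)%N.

Record A3 (T L L0 L1 L2 lam0 : R) n kappa (dims : 'I_n.+1 -> nat)
    (lambda : {measure set (borel 'cV[R]_kappa) -> \bar R})
    (b : R -> 'cV[R]_n -> Pr R n -> 'cV[R]_(\sum_j dims j) -> 'cV[R]_n)
    (sigma : R -> 'cV[R]_n -> Pr R n -> 'cV[R]_(\sum_j dims j) -> 'M[R]_n)
    (gamma : R -> 'cV[R]_n -> Pr R n -> 'cV[R]_kappa -> 'cV[R]_n)
    (f : R -> 'cV[R]_n -> Pr R n -> 'cV[R]_(\sum_j dims j) -> R)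
    (A : forall j, R -> 'cV[R]_n -> Pr R n -> 'cV[R]_(dims j) -> 'cV[R]_n)
    (dA : forall j, R -> 'cV[R]_n -> Pr R n -> 'cV[R]_(dims j) ->
          'cV[R]_n -> 'cV[R]_n)
    (fj : forall j, R -> 'cV[R]_n -> Pr R n -> 'cV[R]_(dims j) -> R)
    (dfj : forall j, R -> 'cV[R]_n -> Pr R n -> 'cV[R]_(dims j) ->
           'cV[R]_n -> R) : Prop := {
  A3_d0 : (0 < dims ord0)%N;
  A3_L0 : 0 <= L0 <= L;
  A3_L1 : 0 <= L1 <= L;
  A3_L2 : 0 <= L2 <= L;
  A3_lam0 : 0 < lam0;
  A3_b : forall t x m v, t \in `[0, T] -> P2 m ->
    b t x m v = A ord0 t x m (submxcol v ord0);
  A3_sigma : forall i : 'I_n, (0 < dims (lift ord0 i))%N ->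
    forall t x m v, t \in `[0, T] -> P2 m ->
    col i (sigma t x m v)
    = A (lift ord0 i) t x m (submxcol v (lift ord0 i));
  A3_A : forall j, activeJ dims j ->
    A3_drift T L L0 L1 L2 lam0 (A j) (dA j);
  A3_sigma_affine : forall i : 'I_n, dims (lift ord0 i) = 0%N ->
    exists (s0 : R -> 'cV[R]_n) (s1 s2 : R -> 'M[R]_n),
    (forall t, t \in `[0, T] ->
       [/\ enorm (s0 t) <= L, opnorm (s1 t) <= L & opnorm (s2 t) <= L]) /\
    (forall t x m v, t \in `[0, T] -> P2 m ->
       col i (sigma t x m v) = s0 t + s1 t *m x + s2 t *m mean m);
  A3_gamma : exists (g0 : R -> 'cV[R]_kappa -> 'cV[R]_n)
    (g1 g2 : R -> 'cV[R]_kappa -> 'M[R]_n),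
    (forall t, t \in `[0, T] ->
       [/\ measurable_fun (@punctured kappa)
             (g0 t : borel 'cV[R]_kappa -> borel 'cV[R]_n),
           measurable_fun (@punctured kappa)
             (g1 t : borel 'cV[R]_kappa -> borel 'M[R]_n) &
           measurable_fun (@punctured kappa)
             (g2 t : borel 'cV[R]_kappa -> borel 'M[R]_n)] /\
       [/\ (L2norm lambda (@punctured kappa) (g0 t) <= L%:E)%E,
           ((\int[lambda]_(e in @punctured kappa) (opnorm (g1 t e) ^+ 2)%:E)
              `^ 2^-1 <= L%:E)%E &
           ((\int[lambda]_(e in @punctured kappa) (opnorm (g2 t e) ^+ 2)%:E)
              `^ 2^-1 <= L%:E)%E]) /\
    (forall t x m e, t \in `[0, T] -> P2 m -> e != 0 ->
       gamma t x m e = g0 t e + g1 t e *m x + g2 t e *m mean m);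
  A3_f : forall t x m v, t \in `[0, T] -> P2 m ->
    f t x m v = \sum_j fj j t x m (submxcol v j);
  A3_fj : forall j, A3_cost T L (fj j) (dfj j) }.

Section A4.
Context d {Omega : measurableType d} (P : probability Omega R).

Definition law n (xi : {mfun Omega >-> borel 'cV[R]_n}) : Pr R n :=
  distribution P xi.

Definition L2 n : set {mfun Omega >-> borel 'cV[R]_n} :=
  [set xi : {mfun Omega >-> borel 'cV[R]_n} |
    (L2norm P setT (fun w => xi w : 'cV[R]_n) < +oo)%E].

(* The expectations are extended-real valued, so that the two convexity
   inequalities do not presuppose integrability of D_y(dg/dnu)(xi).(xi' - xi),
   on which no growth condition is available. *)
Record A4 (T lamv lamx lamm : R) n k
    (f : R -> 'cV[R]_n -> Pr R n -> 'cV[R]_k -> R)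
    (df : R -> 'cV[R]_n -> Pr R n -> 'cV[R]_k -> 'cV[R]_n -> R)
    (g : 'cV[R]_n -> Pr R n -> R)
    (dg : 'cV[R]_n -> Pr R n -> 'cV[R]_n -> R) : Prop := {
  A4_lamv : 0 < lamv;
  A4_lamxm : 0 < lamx + lamm;
  A4_f_differentiable : forall t x m v, t \in `[0, T] -> P2 m ->
    differentiable
      ((fun z => f t z.1 m z.2) : 'cV[R]_n * 'cV[R]_k -> R^o) (x, v);
  A4_f_lfd : forall t x v, t \in `[0, T] ->
    is_lfd (fun m => f t x m v) (fun m => df t x m v);
  A4_df_differentiable : forall t x m v y, t \in `[0, T] -> P2 m ->
    differentiable (df t x m v : 'cV[R]_n -> R^o) y;
  A4_g_differentiable : forall x m, P2 m ->
    differentiable ((fun z => g z m) : 'cV[R]_n -> R^o) x;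
  A4_g_lfd : forall x, is_lfd (fun m => g x m) (fun m => dg x m);
  A4_dg_differentiable : forall x m y, P2 m ->
    differentiable (dg x m : 'cV[R]_n -> R^o) y;
  A4_f_convex : forall t x x' v v' (xi xi' : {mfun Omega >-> borel 'cV[R]_n}),
    t \in `[0, T] -> L2 xi -> L2 xi' ->
    ((dot (grad (fun z => f t z (law xi) v) x) (x' - x)
      + dot (grad (f t x (law xi)) v) (v' - v))%:E
     + 'E_P[fun w => dot (grad (df t x (law xi) v) (xi w))
                         ((xi' w : 'cV[R]_n) - xi w)]
     + (lamv * enorm (v' - v) ^+ 2 + lamx * enorm (x' - x) ^+ 2
        + lamm * fine (L2norm P setT
                   (fun w => (xi' w : 'cV[R]_n) - xi w)) ^+ 2)%:E
     <= (f t x' (law xi') v' - f t x (law xi) v)%:E)%E;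
  A4_g_convex : forall x x' (xi xi' : {mfun Omega >-> borel 'cV[R]_n}),
    L2 xi -> L2 xi' ->
    ((dot (grad (fun z => g z (law xi)) x) (x' - x))%:E
     + 'E_P[fun w => dot (grad (dg x (law xi)) (xi w))
                         ((xi' w : 'cV[R]_n) - xi w)]
     <= (g x' (law xi') - g x (law xi))%:E)%E;
  A4_df_convex : forall t x m v y y', t \in `[0, T] -> P2 m ->
    dot (grad (df t x m v) y) (y' - y) <= df t x m v y' - df t x m v y;
  A4_dg_convex : forall x m y y', P2 m ->
    dot (grad (dg x m) y) (y' - y) <= dg x m y' - dg x m y }.

(* [Xl t] is X_{t-} for t in [0, T], with the convention X_{0-} = X_0. *)
Definition left_limits (T : R) n (X Xl : R -> {mfun Omega >-> borel 'cV[R]_n})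
    : Prop :=
  {ae P, forall w, Xl 0 w = X 0 w /\
    forall t, 0 < t <= T ->
      (X s w : 'cV[R]_n) @[s --> t^'-] --> (Xl t w : 'cV[R]_n)}.

End A4.

Definition first_order n k
    (A : R -> 'cV[R]_n -> Pr R n -> 'cV[R]_k -> 'cV[R]_n)
    (f : R -> 'cV[R]_n -> Pr R n -> 'cV[R]_k -> R)
    (t : R) (x : 'cV[R]_n) (m : Pr R n) (v : 'cV[R]_k) (p : 'cV[R]_n) : Prop :=
  (jac (A t x m) v)^T *m p + grad (f t x m) v = 0.

End Assumptions.

(* Main.v *)
Require Import Defs.
From HB Require Import structures.
From mathcomp Require Import all_boot all_order all_algebra.
From mathcomp Require Import all_classical all_reals all_analysis.
From mathcomp Require Import measurable_realfun.
From mathcomp Require Import lra.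

Set Implicit Arguments.
Unset Strict Implicit.
Unset Printing Implicit Defensive.
Import Order.TTheory GRing.Theory Num.Theory.
Import numFieldNormedType.Exports.
Local Open Scope classical_set_scope.
Local Open Scope ring_scope.

(** The bounds on P and Q^j come from ellipticity: testing A_v A_v^T >= lam0 I
    against p and replacing A_v^T p by - f_v gives lam0 |p| <= L |f_v|, and f_v
    has linear growth. For the bounds on u^j, take xi = xi' and x = x' in the
    convexity inequality of (A4) and let only the j-th control block vary: f^j_v
    is strongly monotone in v^j, so
    2 lamv |u^j|^2 <= (f^j_v(u^j) - f^j_v(0)) . u^j, where again
    f^j_v(u^j) = - A_v^T p. *)

(** * Euclidean geometry and operator norms *)

Section Euclidean.
Context {R : realType}.

Lemma dotC n (x y : 'cV[R]_n) : dot x y = dot y x.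
Proof. by apply: eq_bigr => i _; rewrite mulrC. Qed.

Lemma dotDr n (x y z : 'cV[R]_n) : dot x (y + z) = dot x y + dot x z.
Proof. by rewrite -big_split; apply: eq_bigr => i _; rewrite mxE mulrDr. Qed.

Lemma dotZr n a (x y : 'cV[R]_n) : dot x (a *: y) = a * dot x y.
Proof. by rewrite mulr_sumr; apply: eq_bigr => i _; rewrite mxE mulrCA. Qed.

Lemma dotNr n (x y : 'cV[R]_n) : dot x (- y) = - dot x y.
Proof. by rewrite -scaleN1r dotZr mulN1r. Qed.

Lemma dot0r n (x : 'cV[R]_n) : dot x 0 = 0.
Proof. by rewrite -(scale0r x) dotZr mul0r. Qed.

Lemma dotE n (x y : 'cV[R]_n) : dot x y = (x^T *m y) ord0 ord0.
Proof. by rewrite mxE; apply: eq_bigr => i _; rewrite mxE. Qed.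

Lemma dot_mulmxr m n (M : 'M[R]_(m, n)) x y : dot x (M *m y) = dot (M^T *m x) y.
Proof. by rewrite !dotE trmx_mul trmxK mulmxA. Qed.

Lemma dot_ge0 n (x : 'cV[R]_n) : 0 <= dot x x.
Proof. by apply: sumr_ge0 => i _; rewrite -expr2 sqr_ge0. Qed.

Lemma enorm_ge0 n (x : 'cV[R]_n) : 0 <= enorm x.
Proof. exact: sqrtr_ge0. Qed.

Lemma enorm_sqr n (x : 'cV[R]_n) : enorm x ^+ 2 = dot x x.
Proof. by rewrite sqr_sqrtr // dot_ge0. Qed.

Lemma enorm0 n : enorm (0 : 'cV[R]_n) = 0.
Proof. by rewrite /enorm dot0r sqrtr0. Qed.

Lemma enormZ n a (x : 'cV[R]_n) : enorm (a *: x) = `|a| * enorm x.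
Proof.
by rewrite /enorm dotZr dotC dotZr mulrA -expr2 sqrtrM ?sqr_ge0 // sqrtr_sqr.
Qed.

Lemma enormN n (x : 'cV[R]_n) : enorm (- x) = enorm x.
Proof. by rewrite -scaleN1r enormZ normrN1 mul1r. Qed.

Lemma enorm_eq0 n (x : 'cV[R]_n) : enorm x = 0 -> x = 0.
Proof.
move=> /(congr1 (fun r => r ^+ 2)); rewrite enorm_sqr expr0n /= => /eqP.
rewrite psumr_eq0 => [/allP x0|i _]; last by rewrite -expr2 sqr_ge0.
apply/colP => i; have := x0 i (mem_index_enum i).
by rewrite mulf_eq0 orbb mxE => /eqP.
Qed.

Lemma Cauchy_Schwarz n (x y : 'cV[R]_n) : dot x y <= enorm x * enorm y.
Proof.
have [x0|xn0] := eqVneq (enorm x) 0.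
  by rewrite x0 (enorm_eq0 x0) dotC dot0r mul0r.
have [y0|yn0] := eqVneq (enorm y) 0.
  by rewrite y0 (enorm_eq0 y0) dot0r mulr0.
have x0 : 0 < enorm x by rewrite lt0r xn0 enorm_ge0.
have y0 : 0 < enorm y by rewrite lt0r yn0 enorm_ge0.
(* The square expands to 2 |x|^2 |y|^2 - 2 |x| |y| x . y, and the positive factor |x| |y| is then
   cancelled. *)
have := dot_ge0 (enorm y *: x - enorm x *: y).
rewrite dotDr dotNr !dotZr ![dot (_ - _) _]dotC !dotDr !dotNr !dotZr.
rewrite -!enorm_sqr (dotC y x) => h.
rewrite -(ler_pM2l (mulr_gt0 x0 y0)); lra.
Qed.

(** The Frobenius norm, assembled from the norms of the rows, is an upper bound. This makes the
    [sup] in [opnorm] a genuine least upper bound and not a default value. *)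
Lemma opnorm_has_ubound m n (M : 'M[R]_(m, n)) :
  has_ubound [set enorm (M *m x) | x in [set x : 'cV[R]_n | enorm x <= 1]].
Proof.
exists (Num.sqrt (\sum_i enorm (row i M)^T ^+ 2)) => _ [x /= x1 <-].
apply: ler_wsqrtr; apply: ler_sum => i _.
have Mx : (M *m x) i ord0 = dot (row i M)^T x.
  by rewrite mxE; apply: eq_bigr => k _; rewrite !mxE.
rewrite -expr2 Mx -real_normK ?num_real // ler_sqr ?nnegrE ?enorm_ge0 //.
have M0 := enorm_ge0 (row i M)^T.
(* Used at both x and - x, which bounds the absolute value. *)
have Mx_le : forall z : 'cV[R]_n, enorm z <= 1 ->
    dot (row i M)^T z <= enorm (row i M)^T.
  by move=> z z1; rewrite (le_trans (Cauchy_Schwarz _ _)) // ler_piMr.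
by rewrite ler_norml -lerNl -dotNr !Mx_le // enormN.
Qed.

Lemma enorm_mulmx m n (M : 'M[R]_(m, n)) x :
  enorm (M *m x) <= opnorm M * enorm x.
Proof.
have [x0|xn0] := eqVneq (enorm x) 0.
  by rewrite x0 (enorm_eq0 x0) mulmx0 enorm0 mulr0.
have x0 : 0 < enorm x by rewrite lt0r xn0 enorm_ge0.
rewrite -ler_pdivrMr //.
apply: (ub_le_sup (opnorm_has_ubound M)) => /=.
exists ((enorm x)^-1 *: x) => /=.
  by rewrite enormZ ger0_norm ?invr_ge0 ?enorm_ge0 // mulVf.
by rewrite -scalemxAr enormZ ger0_norm ?invr_ge0 ?enorm_ge0 // mulrC.
Qed.

Lemma enorm_col_mx m n (x : 'cV[R]_m) (y : 'cV[R]_n) :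
  enorm y <= enorm (col_mx x y).
Proof.
apply: ler_wsqrtr; rewrite [leRHS]dotE tr_col_mx mul_row_col mxE -!dotE.
by rewrite lerDr dot_ge0.
Qed.

(** * Gradients, block columns and the two abstract bounds *)

Lemma dot_submxcol k (dims : 'I_k -> nat) (x y : 'cV[R]_(\sum_j dims j)) :
  dot x y = \sum_j dot (submxcol x j) (submxcol y j).
Proof.
rewrite dotE -{1}(submxcolK x) -{1}(submxcolK y) tr_mxcol mul_mxrow_mxcol.
by rewrite summxE; apply: eq_bigr => j _; rewrite dotE.
Qed.

Lemma dot_grad n (k : 'cV[R]_n -> R^o) x h :
  differentiable k x -> dot (grad k x) h = 'D_h k x.
Proof.
move=> dk; rewrite deriveE // [in RHS](matrix_sum_delta h) linear_sum.
apply: eq_bigr => i _; rewrite big_ord1 linearZ /= mxE deriveE // mulrC.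
by rewrite (_ : ord0 = 0).
Qed.

(** One has lam |p|^2 <= p . M M^T p = p . M (- q) <= |p| a c, and a factor |p| cancels. *)
Lemma elliptic_bound m n (a c lam : R) (M : 'M[R]_(m, n)) p q :
  0 < lam -> 0 <= a -> loewner_le lam%:M (M *m M^T) ->
  opnorm M <= a -> M^T *m p + q = 0 -> enorm q <= c ->
  enorm p <= a * c / lam.
Proof.
move=> lam0 a0 ell Ma /eqP; rewrite addr_eq0 => /eqP Mp qc.
rewrite ler_pdivlMr // mulrC.
have [->|pn0] := eqVneq (enorm p) 0.
  by rewrite mulr0 mulr_ge0 // (le_trans (enorm_ge0 q)).
have p0 : 0 < enorm p by rewrite lt0r pn0 enorm_ge0.
rewrite -(ler_pM2l p0); have := ell p.
rewrite mul_scalar_mx dotZr -enorm_sqr expr2 mulrCA => /le_trans; apply.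
rewrite -mulmxA Mp mulmxN dotNr -dotNr -mulmxN.
apply: le_trans (Cauchy_Schwarz _ _) _; rewrite ler_pM2l //.
apply: le_trans (enorm_mulmx _ _) _; rewrite enormN.
apply: le_trans (ler_wpM2r (enorm_ge0 _) Ma) _.
exact: ler_wpM2l.
Qed.

(** Substituting q = - M^T p gives (q - q0) . v = - p . M v - q0 . v <= a |v| (|p| + c), and a
    factor |v| cancels. *)
Lemma coercive_bound m n (a c lam : R) (M : 'M[R]_(m, n)) p q q0 v :
  0 < lam -> opnorm M <= a -> M^T *m p + q = 0 -> enorm q0 <= a * c ->
  2 * lam * enorm v ^+ 2 <= dot (q - q0) v ->
  enorm v <= a / (2 * lam) * (enorm p + c).
Proof.
move=> lam0 Ma /eqP; rewrite addrC addr_eq0 => /eqP -> q0c.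
have v0 := enorm_ge0 v; have p0 := enorm_ge0 p.
rewrite dotC dotDr !dotNr dotC -dot_mulmxr -!dotNr => mono.
have [->|vn0] := eqVneq (enorm v) 0.
  (* For v = 0 the right-hand side must be shown nonnegative; a >= 0 since the set under [sup]
     contains |M 0| = 0. *)
  have a0 : 0 <= a.
    apply: le_trans Ma; apply: (ub_le_sup (opnorm_has_ubound M)) => /=.
    by exists 0; rewrite ?mulmx0 enorm0.
  rewrite mulrAC mulrDr divr_ge0 ?mulr_ge0 ?(ltW lam0) // addr_ge0 //.
    exact: mulr_ge0.
  exact: le_trans (enorm_ge0 _) q0c.
have {}vn0 : 0 < enorm v by rewrite lt0r vn0.
have pv : dot p (- (M *m v)) <= enorm p * (a * enorm v).
  apply: le_trans (Cauchy_Schwarz _ _) _; rewrite enormN ler_wpM2l //.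
  exact: le_trans (enorm_mulmx _ _) (ler_wpM2r v0 Ma).
have qv : dot v (- q0) <= enorm v * (a * c).
  by apply: le_trans (Cauchy_Schwarz _ _) _; rewrite enormN ler_wpM2l.
rewrite mulrAC ler_pdivlMr ?mulr_gt0 // -(ler_pM2l vn0).
by apply: le_trans (le_trans _ mono) (le_trans (lerD pv qv) _); lra.
Qed.

(** Along a direction supported in block j the other summands are constant, so the difference
    quotients on both sides already coincide before passing to the limit. *)
Lemma derive_block k (dims : 'I_k -> nat)
    (phi : forall j, 'cV[R]_(dims j) -> R^o) (h v : 'cV[R]_(\sum_j dims j)) j :
  (forall i, i != j -> submxcol h i = 0) ->
  'D_h ((fun w => \sum_i phi i (submxcol w i)) : _ -> R^o) v
  = 'D_(submxcol h j) (phi j) (submxcol v j).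
Proof.
move=> hj; rewrite /derive; f_equal; f_equal; apply/funext => s /=.
congr (_ *: _); rewrite (bigD1 j) //=. rewrite [X in _ - X](bigD1 j) //= opprD addrACA.
have -> (i : 'I_k) : submxcol (s *: h + v) i = s *: submxcol h i + submxcol v i.
  by apply/colP => ?; rewrite !mxE.
rewrite -[RHS]addr0; congr (_ + _); apply/eqP; rewrite subr_eq0; apply/eqP.
apply: eq_bigr => i /hj h0; congr (phi i _); apply/colP => l.
by have /colP/(_ l) := h0; rewrite !mxE => ->; rewrite mulr0 add0r.
Qed.

(* Strong convexity is used between v and v with its j-th block set to 0; the
   two points share all other blocks, so these drop out of the inequality. *)
Lemma block_strong_monotone k (dims : 'I_k -> nat) (lam : R)
    (f : 'cV[R]_(\sum_j dims j) -> R^o)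
    (phi : forall j, 'cV[R]_(dims j) -> R^o) j v :
  (forall w, f w = \sum_i phi i (submxcol w i)) ->
  (forall w, differentiable f w) -> (forall w, differentiable (phi j) w) ->
  (forall w w', dot (grad f w) (w' - w) + lam * enorm (w' - w) ^+ 2
                <= f w' - f w) ->
  2 * lam * enorm (submxcol v j) ^+ 2
  <= dot (grad (phi j) (submxcol v j) - grad (phi j) 0) (submxcol v j).
Proof.
move=> /funext fE df dphi cvx.
pose w := \mxcol_i (if i == j then 0 else submxcol v i) : 'cV[R]_(\sum_j dims j).
have wj : submxcol w j = 0 by rewrite /w mxcolK eqxx.
have hj : submxcol (v - w) j = submxcol v j by rewrite submxcolB wj subr0.
have hi i : i != j -> submxcol (v - w) i = 0.
  by move=> ij; rewrite submxcolB /w mxcolK (negbTE ij) subrr.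
have gradj z : dot (grad f z) (v - w) = dot (grad (phi j) (submxcol z j)) (submxcol v j).
  by rewrite dot_grad // fE (derive_block _ _ hi) hj -dot_grad.
have enormj : enorm (v - w) = enorm (submxcol v j).
  rewrite /enorm dot_submxcol (bigD1 j) //= [X in _ + X]big1 ?addr0 ?hj // => i /hi ->.
  exact: dot0r.
(* Adding the inequalities from v to w and from w to v cancels the values of f and doubles [lam]. *)
have := cvx v w; have := cvx w v.
rewrite -(opprB v w) dotNr enormN !gradj enormj wj.
by rewrite [dot (_ - _) _]dotC dotDr dotNr 2!(dotC (submxcol v j)); lra.
Qed.

End Euclidean.

(** * Square integrability and the convexity inequality of (A4) *)

Section Probability.
Context {R : realType} d (Omega : measurableType d) (P : probability Omega R).

Lemma measurable_enorm_sqr n :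
  measurable_fun [set: borel 'cV[R]_n]
    (fun x : borel 'cV[R]_n => enorm (x : 'cV[R]_n) ^+ 2).
Proof.
have -> : (fun x : 'cV[R]_n => enorm x ^+ 2) = (fun x => dot x x).
  by apply/funext => x; exact: enorm_sqr.
apply: measurable_sum => i; suff mi : measurable_fun [set: borel 'cV[R]_n]
    (fun x : borel 'cV[R]_n => (x : 'cV[R]_n) i ord0) by exact: measurable_funM.
(* It suffices to test open intervals, whose preimages under the continuous coordinate map are
   open. *)
apply: (measurability _ (RGenOpens.measurableE R)) => _ [_ [a [b ->]] <-].
rewrite setTI; apply: sub_sigma_algebra.
apply: (@open_comp 'cV[R]_n R^o (fun x : 'cV[R]_n => x i ord0)).
  by move=> x _; exact: coord_continuous.
exact: interval_open.
Qed.

(** A change of variables; it bridges (A4), stated for random variables, and (A3), stated for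
    measures. *)
Lemma L2_of_P2_law n (xi : {mfun Omega >-> borel 'cV[R]_n}) :
  P2 (law P xi) -> L2 P xi.
Proof.
rewrite /P2 /L2 /= /law ge0_integral_distribution.
- exact: poweR_lty.
- by apply/measurable_EFinP; exact: measurable_enorm_sqr.
- by move=> y; rewrite lee_fin sqr_ge0.
Qed.

(** With x' = x and xi' = xi the expectation is that of the zero function, and the [lamx] and [lamm]
    terms vanish whatever the signs of these constants. *)
Lemma A4_convex_control T lamv lamx lamm n k f df g dg
    (xi : {mfun Omega >-> borel 'cV[R]_n}) t x (v v' : 'cV[R]_k) :
  A4 P T lamv lamx lamm f df g dg -> t \in `[0, T] -> L2 P xi ->
  dot (grad (f t x (law P xi)) v) (v' - v) + lamv * enorm (v' - v) ^+ 2
  <= f t x (law P xi) v' - f t x (law P xi) v.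
Proof.
move=> hA4 t0T xi2; have := A4_f_convex hA4 x x v v' t0T xi2 xi2.
rewrite subrr dot0r enorm0 expr0n mulr0 add0r addr0.
have -> : (fun w => dot (grad (df t x (law P xi) v) (xi w))
    ((xi w : 'cV[R]_n) - xi w)) = cst 0.
  by apply/funext => w; rewrite subrr dot0r.
have -> : L2norm P setT (fun w => (xi w : 'cV[R]_n) - xi w) = 0%E.
  rewrite /L2norm integral0_eq ?poweR0r ?invr_neq0 // => w _.
  by rewrite subrr enorm0 expr0n.
by rewrite expectation_cst adde0 expr0n mulr0 addr0 -EFinD lee_fin.
Qed.

End Probability.

(** * From the assumptions to the bounds *)

Lemma differentiable_snd_of_joint (R : realType) m n
    (F : 'cV[R]_m * 'cV[R]_n -> R^o) x v :
  differentiable F (x, v) -> differentiable (fun w => F (x, w)) v.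
Proof.
move=> dF; apply: (@differentiable_comp _ _ _ _ (pair x) F) => //.
exact: differentiable_pair.
Qed.

(** The random variable xi enters only through its law, while x, p and v are free vectors. The lemma
    can thus be applied at each outcome separately, for the drift block and the diffusion blocks
    alike. *)
Lemma first_order_bounds (R : realType) d (Omega : measurableType d)
    (P : probability Omega R) T L L0 L1 L2 lam0 lamv lamx lamm n kappa
    (dims : 'I_n.+1 -> nat)
    (lambda : {measure set (borel 'cV[R]_kappa) -> \bar R})
    (b : R -> 'cV[R]_n -> Pr R n -> 'cV[R]_(\sum_j dims j) -> 'cV[R]_n)
    sigma gamma f df g dg
    (A : forall j, R -> 'cV[R]_n -> Pr R n -> 'cV[R]_(dims j) -> 'cV[R]_n)
    dA fj dfj :
  A3 T L L0 L1 L2 lam0 lambda b sigma gamma f A dA fj dfj ->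
  A4 P T lamv lamx lamm f df g dg ->
  forall (j : 'I_n.+1) t (xi : {mfun Omega >-> borel 'cV[R]_n}) x p v,
  let m := law P xi in
  let vj := submxcol v j in
  activeJ dims j -> t \in `[0, T] -> P2 m ->
  first_order (A j) (fj j) t x m vj p ->
  enorm p <= L ^+ 2 / lam0 * (1 + enorm x + moment1 m + enorm vj) /\
  enorm vj <= L / (2 * lamv) * (1 + enorm p + enorm x + moment1 m).
Proof.
move=> hA3 hA4 j t xi x p v m vj act t0T P2m foc.
have hA := A3_A hA3 act; have hf i := A3_fj hA3 i.
have L_ge0 : 0 <= L by have /andP[] := A3_L0 hA3; exact: le_trans.
have fv_le w : enorm (grad (fj j t x m) w)
    <= L * (1 + enorm x + moment1 m + enorm w).
  apply: le_trans (enorm_col_mx _ _) _.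
  exact: (A3_fxv_growth (hf j) x w t0T P2m).
split.
  (* One factor L bounds A_v, the other comes from the growth of f_v. *)
  rewrite expr2 mulrAC -(mulrA L L).
  exact: (elliptic_bound (A3_lam0 hA3) L_ge0 (A3_Av_elliptic hA x vj t0T P2m)
            (A3_Av_bound hA x vj t0T P2m) foc (fv_le vj)).
have -> : 1 + enorm p + enorm x + moment1 m = enorm p + (1 + enorm x + moment1 m).
  by rewrite !addrA (addrC 1).
(* Growth at zero control gives c = 1 + |x| + |m|_1 for the reference gradient q0. *)
have := fv_le 0; rewrite enorm0 addr0 => fv0.
apply: (coercive_bound (A4_lamv hA4) (A3_Av_bound hA x vj t0T P2m) foc fv0).
apply: (block_strong_monotone (f := f t x m) (phi := fun i => fj i t x m)).
- by move=> w; exact: A3_f hA3 _ _ _ _ t0T P2m.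
- move=> w.
  exact: differentiable_snd_of_joint (A4_f_differentiable hA4 x w t0T P2m).
- move=> w.
  exact: differentiable_snd_of_joint (A3_f_differentiable (hf j) x w t0T P2m).
- move=> w w'.
  exact: (A4_convex_control x w w' hA4 t0T (L2_of_P2_law P2m)).
Qed.

Theorem proposition3p6 (R : realType)
  (d : measure_display) (Omega : measurableType d) (P : probability Omega R)
  (hP : measure_is_complete P)
  (T : R) (hT : 0 < T)
  (n kappa : nat) (dims : 'I_n.+1 -> nat)
  (lambda : {measure set (borel 'cV[R]_kappa) -> \bar R})
  (hlambda : (\int[lambda]_(e in @punctured R kappa)
                (1 + enorm (e : 'cV[R]_kappa) ^+ 2)%:E < +oo)%E)
  (L : R) (hL : 0 < L) (L0 L1 L2 lam0 lamv lamx lamm : R)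
  (b : R -> 'cV[R]_n -> Pr R n -> 'cV[R]_(\sum_j dims j) -> 'cV[R]_n)
  (sigma : R -> 'cV[R]_n -> Pr R n -> 'cV[R]_(\sum_j dims j) -> 'M[R]_n)
  (gamma : R -> 'cV[R]_n -> Pr R n -> 'cV[R]_kappa -> 'cV[R]_n)
  (f : R -> 'cV[R]_n -> Pr R n -> 'cV[R]_(\sum_j dims j) -> R)
  (df : R -> 'cV[R]_n -> Pr R n -> 'cV[R]_(\sum_j dims j) -> 'cV[R]_n -> R)
  (g : 'cV[R]_n -> Pr R n -> R)
  (dg : 'cV[R]_n -> Pr R n -> 'cV[R]_n -> R)
  (A : forall j : 'I_n.+1,
     R -> 'cV[R]_n -> Pr R n -> 'cV[R]_(dims j) -> 'cV[R]_n)
  (dA : forall j : 'I_n.+1,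
     R -> 'cV[R]_n -> Pr R n -> 'cV[R]_(dims j) -> 'cV[R]_n -> 'cV[R]_n)
  (fj : forall j : 'I_n.+1, R -> 'cV[R]_n -> Pr R n -> 'cV[R]_(dims j) -> R)
  (dfj : forall j : 'I_n.+1,
     R -> 'cV[R]_n -> Pr R n -> 'cV[R]_(dims j) -> 'cV[R]_n -> R)
  (hA3 : A3 T L L0 L1 L2 lam0 lambda b sigma gamma f A dA fj dfj)
  (hA4 : A4 P T lamv lamx lamm f df g dg)
  (Y Yl Pa Pal : R -> {mfun Omega >-> borel 'cV[R]_n})
  (u : R -> {mfun Omega >-> borel 'cV[R]_(\sum_j dims j)})
  (Q : R -> {mfun Omega >-> borel 'M[R]_n})
  (hY : left_limits P T Y Yl) (hPa : left_limits P T Pa Pal)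
  (hlaw : forall t, t \in `[0, T] -> P2 (law P (Yl t)))
  (hfoc0 : forall t, t \in `[0, T] -> {ae P, forall w,
     first_order (A ord0) (fj ord0) t (Yl t w) (law P (Yl t))
       (submxcol (u t w : 'cV[R]_(\sum_j dims j)) ord0) (Pal t w)})
  (hfoc : forall i : 'I_n, (0 < dims (lift ord0 i))%N ->
     forall t, t \in `[0, T] -> {ae P, forall w,
     first_order (A (lift ord0 i)) (fj (lift ord0 i)) t
       (Yl t w) (law P (Yl t))
       (submxcol (u t w : 'cV[R]_(\sum_j dims j)) (lift ord0 i))
       (col i (Q t w : 'M[R]_n))}) :
  forall t, t \in `[0, T] -> {ae P, forall w,
    let y : 'cV[R]_n := Yl t w in
    let m1 := moment1 (law P (Yl t)) in
    let p : 'cV[R]_n := Pal t w in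
    let v : 'cV[R]_(\sum_j dims j) := u t w in
    let v0 := submxcol v ord0 in
    [/\ enorm p <= L ^+ 2 / lam0 * (1 + enorm y + m1 + enorm v0),
        enorm v0 <= L / (2 * lamv) * (1 + enorm p + enorm y + m1) &
        forall i : 'I_n, (0 < dims (lift ord0 i))%N ->
          let vi := submxcol v (lift ord0 i) in
          let q := col i (Q t w : 'M[R]_n) in
          enorm q <= L ^+ 2 / lam0 * (1 + enorm y + m1 + enorm vi) /\
          enorm vi <= L / (2 * lamv) * (1 + enorm q + enorm y + m1)]}.
Proof.
move=> t t0T.
have hfoci : {ae P, forall w (i : 'I_n), (0 < dims (lift ord0 i))%N ->
    first_order (A (lift ord0 i)) (fj (lift ord0 i)) t (Yl t w) (law P (Yl t))
      (submxcol (u t w : 'cV[R]_(\sum_j dims j)) (lift ord0 i))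
      (col i (Q t w : 'M[R]_n))}.
  (* At fixed t there are finitely many blocks, so their exceptional null sets merge into one; for
     an empty block the implication is vacuous. *)
  apply: filter_forall => i.
  have [di|di] := boolP (0 < dims (lift ord0 i))%N; last exact: nearW.
  by apply: filterS (hfoc i di t t0T).
apply: filterS2 (hfoc0 t t0T) hfoci => w foc0 foci.
have bounds j (act : activeJ dims j) q :=
  first_order_bounds (x := Yl t w) (p := q) (v := u t w)
    hA3 hA4 act t0T (hlaw t t0T).
have [p_le v0_le] := bounds ord0 isT (Pal t w) foc0.
split=> [||i di]; [exact: p_le | exact: v0_le |].
by apply: bounds _ _ _ (foci i di); rewrite /activeJ di orbT.
Qed.
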